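(* Let $f:\mathbb{R}_+\to\mathbb{R}_+$ be non-decreasing and let $\mathcal I=\langle(\ell_t,r_t)\rangle_{t=1}^n$ be an instance of $\mathrm{BMC}_f$. There is a bijection $\phi$ between the schedules for $\mathcal I$ and the trees for $\mathcal I$ such that, for every schedule $\sigma$ and its tree $T=\phi(\sigma)$, for each $t\in\{1,\dots,n\}$: $k_t=1+\mathrm{right\_depth}_T(t)$, and the number of times $\sigma$ merges the file inserted at time $t$ (directly or indirectly) equals $1+\mathrm{left\_depth}_T(t)$. Consequently $\max_t k_t=\mathrm{latency}(T)$ and $\sigma(\mathcal I)=\mathrm{cost}_f(T)$.
   Context: $\mathrm{BMC}_f$: input is a sequence $\mathcal I=\langle(\ell_t,r_t)\rangle_{t=1}^n$ of pairs of nonnegative reals. An algorithm maintains a stack of lengths, initially empty. At time $t$, $\ell_t$ is pushed on top of the stack; then a compaction is chosen: some nonempty contiguous sequence of lengths at the top of the stack is replaced by their sum $L_t$. A schedule $\sigma$ is the sequence of the $n$ compactions; $k_t$ denotes the stack size after the compaction at time $t$, and the cost is $\sigma(\mathcal I)=\sum_{t=1}^n L_t+r_tf(k_t)$. The file inserted at time $t$ is merged (directly or indirectly) at time $t'\ge t$ if the compaction at time $t'$ includes the stack entry whose sum contains $\ell_t$ (the count includes time $t$ itself). A tree for $\mathcal I$ is any $n$-node binary search tree $T$ with keys $\{1,\dots,n\}$. For a key $t$, the path from the root to the node with key $t$ contains $\mathrm{left\_depth}_T(t)$ left-child edges and $\mathrm{right\_depth}_T(t)$ right-child edges. $\mathrm{latency}(T)=\max_{t}\,1+\mathrm{right\_depth}_T(t)$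 and $\mathrm{cost}_f(T)=\sum_{t=1}^n \ell_t(1+\mathrm{left\_depth}_T(t))+r_tf(1+\mathrm{right\_depth}_T(t))$. *)

(* Defs.v *)
From HB Require Import structures.
From mathcomp Require Import all_boot all_order all_algebra.
From mathcomp Require Import reals.

Set Implicit Arguments.
Unset Strict Implicit.
Unset Printing Implicit Defensive.

Import Order.TTheory GRing.Theory Num.Theory.

(* Times, files and keys are natural numbers counted from 1; item t of a
   sequence is stored at index t.-1. *)

Definition ell (R : realType) (n : nat) (I : n.-tuple (R * R)) (t : nat) : R :=
  (nth (0, 0)%R I t.-1).1.

Definition rate (R : realType) (n : nat) (I : n.-tuple (R * R)) (t : nat) : R :=
  (nth (0, 0)%R I t.-1).2.

Definition is_instance (R : realType) (n : nat) (I : n.-tuple (R * R)) : Prop :=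
  forall t, 1 <= t <= n -> (0 <= ell I t)%R /\ (0 <= rate I t)%R.

(* A stack entry: its length, and the insertion times of the files whose
   lengths have been summed into it. *)
Definition entry (R : realType) : Type := (R * seq nat)%type.

Definition merge_entries (R : realType) (es : seq (entry R)) : entry R :=
  ((\sum_(e <- es) e.1)%R, flatten [seq e.2 | e <- es]).

(* A compaction is encoded by the number c of top entries that it merges; the
   head of the sequence is the top of the stack. *)
Definition compact (R : realType) (c : nat) (s : seq (entry R)) :
    seq (entry R) :=
  merge_entries (take c s) :: drop c s.

Definition compaction (n : nat) (sigma : n.-tuple nat) (t : nat) : nat :=
  nth 0 sigma t.-1.

Definition push (R : realType) (n : nat) (I : n.-tuple (R * R)) (t : nat)
    (s : seq (entry R)) : seq (entry R) :=
  (ell I t, [:: t]) :: s.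

(* The stack after the compaction at time t. *)
Fixpoint stack (R : realType) (n : nat) (I : n.-tuple (R * R))
    (sigma : n.-tuple nat) (t : nat) : seq (entry R) :=
  if t is t'.+1 then compact (compaction sigma t) (push I t (stack I sigma t'))
  else [::].

(* The stack at time t >= 1, between the push and the compaction. *)
Definition pushed_stack (R : realType) (n : nat) (I : n.-tuple (R * R))
    (sigma : n.-tuple nat) (t : nat) : seq (entry R) :=
  push I t (stack I sigma t.-1).

Definition compacted (R : realType) (n : nat) (I : n.-tuple (R * R))
    (sigma : n.-tuple nat) (t : nat) : seq (entry R) :=
  take (compaction sigma t) (pushed_stack I sigma t).

Definition is_schedule (R : realType) (n : nat) (I : n.-tuple (R * R))
    (sigma : n.-tuple nat) : bool :=
  all (fun t => 1 <= compaction sigma t <= size (pushed_stack I sigma t))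
      (iota 1 n).

Definition schedule (R : realType) (n : nat) (I : n.-tuple (R * R)) : Type :=
  {sigma : n.-tuple nat | is_schedule I sigma}.

Definition stack_size (R : realType) (n : nat) (I : n.-tuple (R * R))
    (sigma : schedule I) (t : nat) : nat :=
  size (stack I (val sigma) t).

Definition compaction_length (R : realType) (n : nat) (I : n.-tuple (R * R))
    (sigma : schedule I) (t : nat) : R :=
  (\sum_(e <- compacted I (val sigma) t) e.1)%R.

Definition merged_at (R : realType) (n : nat) (I : n.-tuple (R * R))
    (sigma : schedule I) (t t' : nat) : bool :=
  has (fun e : entry R => t \in e.2) (compacted I (val sigma) t').

Definition num_merges (R : realType) (n : nat) (I : n.-tuple (R * R))
    (sigma : schedule I) (t : nat) : nat :=
  count (merged_at sigma t) (index_iota t n.+1).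

Definition schedule_cost (R : realType) (n : nat) (I : n.-tuple (R * R))
    (f : R -> R) (sigma : schedule I) : R :=
  (\sum_(1 <= t < n.+1)
     (compaction_length sigma t + rate I t * f (stack_size sigma t)%:R))%R.

Inductive bintree : Type :=
| Leaf
| Node of bintree & nat & bintree.

Fixpoint keys (T : bintree) : seq nat :=
  if T is Node l k r then keys l ++ k :: keys r else [::].

Fixpoint is_bst (T : bintree) : bool :=
  if T is Node l k r then
    [&& all (fun x => x < k) (keys l), all (fun x => k < x) (keys r),
        is_bst l & is_bst r]
  else true.

Definition is_tree (n : nat) (T : bintree) : bool :=
  is_bst T && perm_eq (keys T) (iota 1 n).

Definition bst (n : nat) : Type := {T : bintree | is_tree n T}.

(* The edges of the path from the root to the node with key t, found by binary
   search: true for a left-child edge, false for a right-child edge. *)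
Fixpoint root_path (T : bintree) (t : nat) : seq bool :=
  if T is Node l k r then
    if t == k then [::]
    else if t < k then true :: root_path l t else false :: root_path r t
  else [::].

Definition left_depth (n : nat) (T : bst n) (t : nat) : nat :=
  count_mem true (root_path (val T) t).

Definition right_depth (n : nat) (T : bst n) (t : nat) : nat :=
  count_mem false (root_path (val T) t).

Definition latency (n : nat) (T : bst n) : nat :=
  \max_(1 <= t < n.+1) (1 + right_depth T t).

Definition tree_cost (R : realType) (n : nat) (I : n.-tuple (R * R))
    (f : R -> R) (T : bst n) : R :=
  (\sum_(1 <= t < n.+1)
     (ell I t * (1 + left_depth T t)%N%:R
      + rate I t * f (1 + right_depth T t)%N%:R))%R.

(* Main.v *)
Require Import Defs.
From HB Require Import structures.
From mathcomp Require Import all_boot all_order all_algebra.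
From mathcomp Require Import reals.
From mathcomp Require Import zify.

(* Read the trees on the keys 1, ..., t as t grows. The nodes of the right
   spine of the tree at time t, together with their left subtrees, are the
   entries of the stack. Key t+1 is larger than all others, so it enters at the
   end of the right spine; a compaction of c entries cuts off the last c-1 spine
   nodes and hangs them, as left subtree, below the new node t+1. This adds one
   left edge above exactly the files being merged and changes no right depth.
   Removing the largest key undoes the step, hence the bijection. *)

Import GRing.Theory.

(** * Inserting and deleting the largest key *)

Fixpoint insert_max (d m : nat) (T : bintree) : bintree :=
  match d, T with
  | d'.+1, Node l k r => Node l k (insert_max d' m r)
  | _, _ => Node T m Leaf
  end.

Fixpoint delete_max (T : bintree) : bintree :=
  match T with
  | Leaf => Leaf
  | Node l _ Leaf => l
  | Node l k r => Node l k (delete_max r)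
  end.

Fixpoint spine_subtree (d : nat) (T : bintree) : bintree :=
  match d, T with
  | d'.+1, Node _ _ r => spine_subtree d' r
  | 0, _ => T
  | _, Leaf => Leaf
  end.

(* Lowest spine node first, keys in decreasing order: this is the order in which
   [compact] concatenates the files of the merged entries. *)
Fixpoint blocks (T : bintree) : seq (seq nat) :=
  if T is Node l k r then rcons (blocks r) (k :: rev (keys l)) else [::].

Definition spine (T : bintree) : nat := size (blocks T).

Lemma spine_Node (l : bintree) (k : nat) (r : bintree) :
  spine (Node l k r) = (spine r).+1.
Proof. by rewrite /spine size_rcons. Qed.

Lemma flatten_blocks (T : bintree) : flatten (blocks T) = rev (keys T).
Proof.
elim: T => //= l _ k r IHr.
by rewrite flatten_rcons IHr rev_cat rev_cons cat_rcons.
Qed.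

Lemma keys_insert_max (d m : nat) (T : bintree) :
  keys (insert_max d m T) = rcons (keys T) m.
Proof.
elim: d T => [|d IHd] [|l k r] //=; rewrite ?cats1 //.
by rewrite IHd -rcons_cons rcons_cat.
Qed.

(** The tree counterpart of [compact]: blocks are listed from the bottom of the spine, so the nodes
    cut off form a prefix of length [spine T - d]. *)
Lemma blocks_insert_max (d m : nat) (T : bintree) : d <= spine T ->
  blocks (insert_max d m T) =
  (m :: rev (keys (spine_subtree d T))) :: drop (spine T - d) (blocks T).
Proof.
elim: d T => [|d IHd] [|l k r] //= => [_|].
  by rewrite subn0 drop_size.
rewrite spine_Node ltnS => le_d; rewrite IHd // subSS drop_rcons //.
exact: leq_subr.
Qed.

Lemma spine_insert_max (d m : nat) (T : bintree) : d <= spine T ->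
  spine (insert_max d m T) = d.+1.
Proof.
move=> le_d; rewrite /spine blocks_insert_max //= size_drop -/(spine T).
by rewrite subKn.
Qed.

Lemma flatten_take_blocks (d : nat) (T : bintree) :
  flatten (take (spine T - d) (blocks T)) = rev (keys (spine_subtree d T)).
Proof.
elim: d T => [|d IHd] [|l k r] //=.
  by rewrite subn0 take_size flatten_blocks.
rewrite spine_Node subSS -cats1 takel_cat ?IHd //; exact: leq_subr.
Qed.

Lemma delete_insert_max (d m : nat) (T : bintree) :
  delete_max (insert_max d m T) = T.
Proof.
elim: d T => [|d IHd] [|l k r] //=.
(* [delete_max] recurses only into a right child that is a node, so the result of the insertion must
   first be exposed as one. *)
by have := IHd r; case: d {IHd} => [|d]; case: r => //= l' k' r' ->.
Qed.

(** The deleted node ends the spine, with [(spine T).-1] nodes above it. Its key is identified in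
    [keys_delete_max]. *)
Lemma insert_delete_max (T : bintree) : 0 < spine T ->
  exists m, T = insert_max (spine T).-1 m (delete_max T).
Proof.
elim: T => // l _ k [|l' k' r'] IHr _; first by exists k.
have [|m def_r] := IHr; first by rewrite spine_Node.
exists m; rewrite spine_Node /= -/(delete_max (Node l' k' r')).
by rewrite {1}def_r spine_Node.
Qed.

(** The spine loses its last node and gains the right spine of that node's left subtree. The bound
    will make the compactions read off a tree nonempty. *)
Lemma spine_delete_max (T : bintree) : spine T <= (spine (delete_max T)).+1.
Proof.
elim: T => // l _ k [|l' k' r'] IHr; first by rewrite spine_Node.
change (delete_max (Node l k (Node l' k' r')))
  with (Node l k (delete_max (Node l' k' r'))).
by rewrite !(spine_Node l).
Qed.

Lemma spine_gt0 (T : bintree) : (0 < spine T) = (0 < size (keys T)).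
Proof. by case: T => // l k r; rewrite spine_Node /= size_cat addnS. Qed.

(** * Search trees and root paths *)

Lemma is_bst_sorted (T : bintree) : is_bst T = sorted ltn (keys T).
Proof.
have trans : transitive ltn by exact: ltn_trans.
elim: T => // l IHl k r IHr.
rewrite /= IHl IHr !(sorted_pairwise trans) pairwise_cat allrel_consr /=.
apply/idP/idP.
- case/and4P=> lk kr -> ->; rewrite lk kr !andbT /=.
  apply/allrelP=> x y /(allP lk) xk /(allP kr); exact: ltn_trans.
- by case/and3P=> /andP[-> _] -> /andP[-> ->].
Qed.

(** A strictly increasing list is determined by its members. The search-tree condition thus becomes
    an equation on key lists, easy to follow through insertions and deletions. *)
Lemma is_treeE (n : nat) (T : bintree) : is_tree n T = (keys T == iota 1 n).
Proof.
rewrite /is_tree is_bst_sorted; apply/andP/eqP=> [[sT pT]|->].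
  exact: (irr_sorted_eq ltn_trans ltnn sT (iota_ltn_sorted 1 n) (perm_mem pT)).
by rewrite iota_ltn_sorted.
Qed.

Lemma mem_spine_subtree (d : nat) (T : bintree) :
  {subset keys (spine_subtree d T) <= keys T}.
Proof.
elim: d T => [|d IHd] [|l k r] //= x /IHd x_r.
by rewrite mem_cat inE x_r !orbT.
Qed.

(** A path into the cut-off subtree now passes through the new node and leaves it by a left edge,
    since [t < m]; other paths are unchanged. *)
Lemma root_path_insert_max (d m : nat) (T : bintree) (t : nat) :
  is_bst T -> t \in keys T -> t < m ->
  count_mem false (root_path (insert_max d m T) t) =
    count_mem false (root_path T t) /\
  count_mem true (root_path (insert_max d m T) t) =
    count_mem true (root_path T t) + (t \in keys (spine_subtree d T)).
Proof.
move=> bT tT tm; elim: d T bT tT => [|d IHd] [|l k r] //.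
  move=> _ tT; rewrite [insert_max _ _ _]/= [spine_subtree _ _]/= tT /=.
  by rewrite ltn_eqF // tm addnC.
move=> /= /and4P[lk kr bl br].
have sub := mem_spine_subtree d r.
rewrite mem_cat inE.
case: ltngtP => [tk|kt|->] /=.
(* Keys of [r] exceed [k], so for [t < k], and likewise for [t = k] below, the added term is 0. *)
- by move=> _; case: (boolP (t \in _)) => [/sub /(allP kr) /ltn_geF|]; lia.
- case: (boolP (t \in keys l)) => [/(allP lk)|_ t_r].
    by rewrite ltnNge ltnW.
  by have [-> ->] := IHd r br t_r.
- by move=> _; case: (boolP (k \in _)) => [/sub /(allP kr) /=|]; rewrite ?ltnn.
Qed.

Lemma root_path_inserted (d m : nat) (T : bintree) :
  all (fun x => x < m) (keys T) -> d <= spine T ->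
  root_path (insert_max d m T) m = nseq d false.
Proof.
elim: d T => [|d IHd] [|l k r] //=; rewrite ?eqxx // spine_Node ltnS.
rewrite all_cat /= => /and3P[_ km rm] le_d.
by rewrite gtn_eqF // ltnNge ltnW //= IHd.
Qed.

(** * The tree grown by a sequence of compactions *)

(** With the new file the stack has [spine T + 1] entries; merging [c t] of them leaves
    [spine T + 1 - c t] spine nodes above the new one. *)
Fixpoint tree_at (c : nat -> nat) (t : nat) : bintree :=
  if t is t'.+1 then
    let T := tree_at c t' in insert_max ((spine T).+1 - c t) t T
  else Leaf.

Lemma keys_tree_at (c : nat -> nat) (t : nat) : keys (tree_at c t) = iota 1 t.
Proof.
elim: t => // t IHt.
by rewrite [tree_at _ _]/= keys_insert_max IHt -cats1 -[t.+1]addn1 iotaD addnC.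
Qed.

Lemma is_tree_tree_at (c : nat -> nat) (n : nat) : is_tree n (tree_at c n).
Proof. by rewrite is_treeE keys_tree_at. Qed.

Lemma spine_tree_at (c : nat -> nat) (t : nat) : 0 < c t.+1 ->
  spine (tree_at c t.+1) = ((spine (tree_at c t)).+1 - c t.+1).+1.
Proof. by move=> c_gt0; rewrite spine_insert_max //; lia. Qed.

Lemma root_path_last (c : nat -> nat) (m : nat) : 0 < c m.+1 ->
  root_path (tree_at c m.+1) m.+1 =
  nseq ((spine (tree_at c m)).+1 - c m.+1) false.
Proof.
move=> c_gt0; apply: root_path_inserted; last by lia.
by apply/allP=> x; rewrite keys_tree_at mem_iota; lia.
Qed.

(** The new file is itself one of the merged entries, so old blocks are taken only up to
    [(c m.+1).-1]. *)
Lemma root_path_step (c : nat -> nat) (t m : nat) : 0 < c m.+1 -> 0 < t <= m ->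
  count_mem false (root_path (tree_at c m.+1) t) =
    count_mem false (root_path (tree_at c m) t) /\
  count_mem true (root_path (tree_at c m.+1) t) =
    count_mem true (root_path (tree_at c m) t)
    + (t \in flatten (take (c m.+1).-1 (blocks (tree_at c m)))).
Proof.
move=> c_gt0 t_m; set T := tree_at c m.
have -> : t \in flatten (take (c m.+1).-1 (blocks T)) =
          (t \in keys (spine_subtree ((spine T).+1 - c m.+1) T)).
  rewrite -[RHS]mem_rev -flatten_take_blocks; congr (_ \in flatten _).
  case: (leqP (c m.+1) (spine T).+1) => c_le; first by congr take; lia.
  by rewrite !take_oversize // -/(spine T); lia.
apply: root_path_insert_max; first by case/andP: (is_tree_tree_at c m).
  by rewrite keys_tree_at mem_iota; lia.
by lia.
Qed.

(** At time [t] the path to [t] is the whole right spine, and later insertions change no right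
    depth. *)
Lemma right_depth_tree_at (c : nat -> nat) (t m : nat) :
  (forall s, 0 < s <= m -> 0 < c s) -> 0 < t <= m ->
  spine (tree_at c t) = 1 + count_mem false (root_path (tree_at c m) t).
Proof.
elim: m => [|m IHm] c_gt0; first by case: t.
have cm_gt0 : 0 < c m.+1 by apply: c_gt0; lia.
case/andP=> t_gt0; rewrite leq_eqVlt => /predU1P[->|].
  by rewrite spine_tree_at // root_path_last // count_nseq mul1n.
rewrite ltnS => t_m; have t_bd : 0 < t <= m by lia.
have [-> _] := root_path_step c t m cm_gt0 t_bd.
by apply: IHm => // s s_m; apply: c_gt0; lia.
Qed.

(** Induction on [m]: the compaction at time [t] gives the 1, as node [t] starts with no left edge
    above it; each later one counts exactly when it adds a left edge. *)
Lemma left_depth_tree_at (c : nat -> nat) (t m : nat) :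
  (forall s, 0 < s <= m -> 0 < c s) -> 0 < t <= m ->
  count (fun s => (t == s) ||
           (t \in flatten (take (c s).-1 (blocks (tree_at c s.-1)))))
    (index_iota t m.+1) =
  1 + count_mem true (root_path (tree_at c m) t).
Proof.
elim: m => [|m IHm] c_gt0; first by case: t.
have cm_gt0 : 0 < c m.+1 by apply: c_gt0; lia.
case/andP=> t_gt0; rewrite leq_eqVlt => /predU1P[->|].
  by rewrite root_path_last // count_nseq /index_iota subSnn /= eqxx.
rewrite ltnS => t_m; have t_bd : 0 < t <= m by lia.
have [_ ->] := root_path_step c t m cm_gt0 t_bd.
rewrite addnA -IHm //; last by move=> s s_m; apply: c_gt0; lia.
rewrite /index_iota subSn 1?leqW // -addn1 iotaD count_cat /= addn0.
by rewrite subnKC 1?leqW // ltn_eqF.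
Qed.

(** * Stack entries as spine blocks *)

(** Only positivity is assumed, because [is_scheduleP] uses this invariant to turn the bound by
    stack size into a bound by spine length. *)
Lemma files_stack (R : realType) (n : nat) (I : n.-tuple (R * R))
    (sigma : n.-tuple nat) (t : nat) :
  (forall s, 0 < s <= t -> 0 < compaction sigma s) ->
  [seq e.2 | e <- stack I sigma t] = blocks (tree_at (compaction sigma) t).
Proof.
elim: t => //= t IHt c_gt0.
have {IHt} IHt := IHt (fun s s_t => c_gt0 s ltac:(lia)).
have := c_gt0 t.+1; rewrite ltnSn => /(_ isT).
rewrite blocks_insert_max; last by have := c_gt0 t.+1; lia.
case: (compaction sigma t.+1) => // c _.
rewrite subSS -flatten_take_blocks /= map_take map_drop IHt.
case: (leqP c (spine (tree_at (compaction sigma) t))) => c_le.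
  by rewrite subKn.
(* An oversized compaction merges the whole stack, and truncated subtraction places the new node at
   the root. *)
rewrite !take_oversize ?drop_oversize -?/(spine _) //; lia.
Qed.

Lemma is_scheduleP (R : realType) (n : nat) (I : n.-tuple (R * R))
    (sigma : n.-tuple nat) :
  let c := compaction sigma in
  reflect (forall s, 0 < s <= n -> 0 < c s <= (spine (tree_at c s.-1)).+1)
    (is_schedule I sigma).
Proof.
move=> c.
have size_stack s : (forall s, 0 < s <= n -> 0 < c s) -> 0 < s <= n ->
    size (pushed_stack I sigma s) = (spine (tree_at c s.-1)).+1.
  move=> c_gt0 s_n; rewrite /= /spine -(@files_stack R n I) ?size_map //.
  by move=> r r_s; apply: c_gt0; lia.
apply: (iffP allP) => valid s s_n.
  have c_gt0 r : 0 < r <= n -> 0 < c r.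
    by move=> r_n; have := valid r; rewrite mem_iota add1n => /(_ r_n) /andP[].
  by rewrite -size_stack //; apply: valid; rewrite mem_iota.
have {}s_n : 0 < s <= n by rewrite mem_iota in s_n.
by rewrite size_stack ?valid // => r /valid /andP[].
Qed.

Lemma compaction_gt0 (R : realType) (n : nat) (I : n.-tuple (R * R))
    (sigma : schedule I) (t : nat) :
  0 < t <= n -> 0 < compaction (val sigma) t.
Proof. by case/(is_scheduleP R n I (val sigma) (valP sigma))/andP. Qed.

(** * Recovering the schedule from a tree *)

Lemma keys_delete_max (T : bintree) (m : nat) : keys T = iota 1 m.+1 ->
  keys (delete_max T) = iota 1 m /\
  T = insert_max (spine T).-1 m.+1 (delete_max T).
Proof.
move=> keysT; have [|k defT] := insert_delete_max T.
  by rewrite spine_gt0 keysT size_iota.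
have := keysT; rewrite {1}defT keys_insert_max.
rewrite -[m.+1]addn1 iotaD cats1 add1n addn1.
by move=> /rcons_inj[-> def_k]; rewrite -def_k.
Qed.

(** Time run backwards: on a tree with keys [1] to [n], the deletions remove the keys [n] down to
    [t + 1] and leave the tree of time [t]. *)
Definition prune (n : nat) (T : bintree) (t : nat) : bintree :=
  iter (n - t) delete_max T.

Lemma prune_step (n : nat) (T : bintree) (t : nat) : t < n ->
  prune n T t = delete_max (prune n T t.+1).
Proof. by move=> t_n; rewrite /prune -iterS -subSn // subSS. Qed.

Lemma keys_prune (n : nat) (T : bintree) (t : nat) :
  keys T = iota 1 n -> t <= n -> keys (prune n T t) = iota 1 t.
Proof.
move=> keysT t_n; have : keys T = iota 1 (n - t + t) by rewrite subnK.
rewrite /prune; elim: (n - t) T {keysT} => //= d IHd T keysT.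
by rewrite -iterS iterSr; apply: IHd; case: (keys_delete_max _ _ keysT).
Qed.

(** This solves [spine_tree_at] for the compaction at time [i + 1]. *)
Definition compactions_of (n : nat) (T : bintree) : n.-tuple nat :=
  [tuple (spine (prune n T i)).+2 - spine (prune n T i.+1) | i < n].

Lemma compaction_compactions_of (n : nat) (T : bintree) (t : nat) : t < n ->
  compaction (compactions_of n T) t.+1 =
  (spine (prune n T t)).+2 - spine (prune n T t.+1).
Proof.
move=> t_n; rewrite /compaction.
by rewrite -[t.+1.-1]/(val (Ordinal t_n)) -tnth_nth tnth_mktuple.
Qed.

Lemma tree_at_compactions_of (n : nat) (T : bintree) (t : nat) :
  keys T = iota 1 n -> t <= n ->
  tree_at (compaction (compactions_of n T)) t = prune n T t.
Proof.
move=> keysT; elim: t => [_|t IHt t_n].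
  have := keys_prune n T 0 keysT (leq0n n).
  by case: (prune n T 0) => //= l k r; case: (keys l).
rewrite [tree_at _ _]/= IHt 1?ltnW // compaction_compactions_of //.
have [_ def_prune] := keys_delete_max _ _ (keys_prune n T t.+1 keysT t_n).
rewrite [RHS]def_prune -prune_step //; congr insert_max.
(* No subtraction truncates: the spine at time [t + 1] is nonempty and at most one longer than at
   time [t]. *)
have := spine_delete_max (prune n T t.+1); rewrite -prune_step //.
have := spine_gt0 (prune n T t.+1); rewrite keys_prune // size_iota; lia.
Qed.

Lemma is_schedule_compactions_of (R : realType) (n : nat)
    (I : n.-tuple (R * R)) (T : bintree) :
  is_tree n T -> is_schedule I (compactions_of n T).
Proof.
rewrite is_treeE => /eqP keysT; apply/is_scheduleP => -[//|t] /= t_n.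
rewrite compaction_compactions_of //.
rewrite (tree_at_compactions_of _ _ _ keysT (ltnW t_n)).
have := spine_delete_max (prune n T t.+1); rewrite -prune_step //.
have := spine_gt0 (prune n T t.+1); rewrite keys_prune // size_iota; lia.
Qed.

Lemma prune_tree_at (c : nat -> nat) (n t : nat) : t <= n ->
  prune n (tree_at c n) t = tree_at c t.
Proof.
move=> t_n; rewrite /prune -[in tree_at c n](subnK t_n).
elim: (n - t) => // d IHd.
by rewrite iterSr addSn [tree_at _ _.+1]/= delete_insert_max.
Qed.

Lemma compactions_of_tree_at (n : nat) (sigma : n.-tuple nat) :
  let c := compaction sigma in
  (forall s, 0 < s <= n -> 0 < c s <= (spine (tree_at c s.-1)).+1) ->
  compactions_of n (tree_at c n) = sigma.
Proof.
move=> c valid; apply: eq_from_tnth => i.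
rewrite tnth_mktuple !prune_tree_at ?(ltnW (ltn_ord i)) //.
have /andP[c_gt0 c_le] : 0 < c i.+1 <= (spine (tree_at c i)).+1.
  exact/valid/ltn_ord.
rewrite spine_tree_at // subSS subKn //.
by rewrite /c /compaction (tnth_nth 0).
Qed.

Definition tree_of (R : realType) (n : nat) (I : n.-tuple (R * R))
    (sigma : schedule I) : bst n :=
  exist (fun T => is_tree n T) _ (is_tree_tree_at (compaction (val sigma)) n).

Definition schedule_of (R : realType) (n : nat) (I : n.-tuple (R * R))
    (T : bst n) : schedule I :=
  exist (fun sigma => is_schedule I sigma) _
    (is_schedule_compactions_of R n I _ (valP T)).

Lemma tree_of_bijective (R : realType) (n : nat) (I : n.-tuple (R * R)) :
  bijective (tree_of R n I).
Proof.
exists (schedule_of R n I) => [sigma | T]; apply: val_inj => /=.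
  apply: compactions_of_tree_at; exact/is_scheduleP/(valP sigma).
rewrite tree_at_compactions_of //; first by rewrite /prune subnn.
by apply/eqP; rewrite -is_treeE (valP T).
Qed.

(** * Files merged by a compaction, and costs *)

Lemma files_compacted (R : realType) (n : nat) (I : n.-tuple (R * R))
    (sigma : n.-tuple nat) (t : nat) :
  let c := compaction sigma in
  (forall s, 0 < s <= n -> 0 < c s) -> 0 < t <= n ->
  flatten [seq e.2 | e <- compacted I sigma t] =
  t :: flatten (take (c t).-1 (blocks (tree_at c t.-1))).
Proof.
move=> c c_gt0 t_n; rewrite /compacted map_take /= files_stack -/c.
  by case: (c t) (c_gt0 t t_n).
by move=> s s_t; apply: c_gt0; lia.
Qed.

(** The blocks at time [t - 1] partition the keys [1] to [t - 1], and [t] is new. Hence lengths can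
    be summed over times, and no file is merged before its insertion. *)
Lemma uniq_files_compacted (R : realType) (n : nat) (I : n.-tuple (R * R))
    (sigma : n.-tuple nat) (t : nat) :
  (forall s, 0 < s <= n -> 0 < compaction sigma s) -> 0 < t <= n ->
  let files := flatten [seq e.2 | e <- compacted I sigma t] in
  uniq files /\ {subset files <= iota 1 t}.
Proof.
move=> c_gt0 t_n; rewrite /= files_compacted //.
set c := compaction sigma; set bs := take _ _.
have keys_cat : flatten bs ++ flatten (drop (c t).-1 (blocks (tree_at c t.-1)))
    = rev (iota 1 t.-1).
  by rewrite -flatten_cat cat_take_drop flatten_blocks keys_tree_at.
have sub_bs : {subset flatten bs <= iota 1 t.-1}.
  by move=> x x_bs; rewrite -mem_rev -keys_cat mem_cat x_bs.
have : uniq (rev (iota 1 t.-1)) by rewrite rev_uniq iota_uniq.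
rewrite -keys_cat cat_uniq => /andP[uniq_bs _]; split=> [|x].
  by rewrite /= uniq_bs andbT; apply/negP=> /sub_bs; rewrite mem_iota; lia.
by rewrite inE => /predU1P[->|/sub_bs]; rewrite !mem_iota; lia.
Qed.

Lemma merged_atE (R : realType) (n : nat) (I : n.-tuple (R * R))
    (sigma : schedule I) (t t' : nat) :
  merged_at sigma t t' =
  (t \in flatten [seq e.2 | e <- compacted I (val sigma) t']).
Proof.
by rewrite /merged_at; elim: compacted => //= e s IHs; rewrite mem_cat IHs.
Qed.

Lemma stack_lengths (R : realType) (n : nat) (I : n.-tuple (R * R))
    (sigma : n.-tuple nat) (t : nat) :
  all (fun e => e.1 == \sum_(x <- e.2) ell I x)%R (stack I sigma t).
Proof.
elim: t => //= t IHt; set s := push _ _ _.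
have : all (fun e => e.1 == \sum_(x <- e.2) ell I x)%R s.
  by rewrite /= big_seq1 eqxx.
rewrite -{1}[s](cat_take_drop (compaction sigma t.+1)) all_cat => /andP[tk ->].
rewrite andbT /= big_flatten big_map; apply/eqP/eq_big_seq => e.
by move=> /(allP tk)/eqP.
Qed.

Lemma compaction_lengthE (R : realType) (n : nat) (I : n.-tuple (R * R))
    (sigma : schedule I) (t' : nat) : 0 < t' <= n ->
  (compaction_length sigma t' =
   \sum_(1 <= t < n.+1 | merged_at sigma t t') ell I t)%R.
Proof.
move=> t'_n; have c_gt0 := compaction_gt0 R n I sigma.
rewrite /compaction_length.
transitivity (\sum_(x <- flatten [seq e.2 | e <- compacted I (val sigma) t'])
                ell I x)%R.
  rewrite big_flatten big_map; apply: eq_big_seq => e /mem_take.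
  rewrite inE => /predU1P[->|]; first by rewrite big_seq1.
  by move=> /(allP (stack_lengths R n I (val sigma) t'.-1))/eqP.
rewrite -[RHS]big_filter; apply: perm_big.
under eq_filter do rewrite merged_atE.
have [uniq_files files_le] := uniq_files_compacted R n I _ _ c_gt0 t'_n.
apply: uniq_perm; rewrite ?filter_uniq ?iota_uniq // => x.
rewrite mem_filter; case: (boolP (x \in _)) => //= /files_le.
by rewrite mem_index_iota mem_iota; lia.
Qed.

(** Counting from time 1 adds nothing. A range independent of [t] is what the exchange of sums in
    [sum_compaction_length] requires. *)
Lemma num_mergesE (R : realType) (n : nat) (I : n.-tuple (R * R))
    (sigma : schedule I) (t : nat) : 0 < t <= n ->
  num_merges sigma t = count (merged_at sigma t) (index_iota 1 n.+1).
Proof.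
move=> t_n; have c_gt0 := compaction_gt0 R n I sigma.
rewrite [RHS](_ : _ =
    count (merged_at sigma t) (index_iota 1 t) + num_merges sigma t).
  rewrite (eq_in_count (a2 := pred0)) ?count_pred0 // => s.
  rewrite mem_index_iota merged_atE => s_t; apply/negP.
  have s_n : 0 < s <= n by lia.
  have [_ files_le] := uniq_files_compacted R n I _ _ c_gt0 s_n.
  by move=> /files_le; rewrite mem_iota; lia.
rewrite /num_merges -count_cat /index_iota; congr count.
have -> : n.+1 - 1 = (t - 1) + (n.+1 - t) by lia.
by rewrite iotaD; congr (_ ++ iota _ _); lia.
Qed.

(** Double counting of the pairs of a file and a compaction that merges it, weighted by the file's
    length. *)
Lemma sum_compaction_length (R : realType) (n : nat) (I : n.-tuple (R * R))
    (sigma : schedule I) :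
  (\sum_(1 <= t < n.+1) compaction_length sigma t =
   \sum_(1 <= t < n.+1) ell I t * (num_merges sigma t)%:R)%R.
Proof.
under eq_big_nat => t t_n do rewrite compaction_lengthE // big_mkcond.
rewrite exchange_big_nat /=; apply: eq_big_nat => t t_n.
rewrite num_mergesE // -big_mkcond -sum1_count natr_sum mulr_sumr.
by apply: eq_bigr => s _; rewrite mulr1.
Qed.

Lemma stack_sizeE (R : realType) (n : nat) (I : n.-tuple (R * R))
    (sigma : schedule I) (t : nat) : 0 < t <= n ->
  stack_size sigma t = 1 + right_depth (tree_of R n I sigma) t.
Proof.
move=> t_n; have c_gt0 := compaction_gt0 R n I sigma.
rewrite -(right_depth_tree_at _ _ _ c_gt0 t_n) /spine -(@files_stack R n I).
  by rewrite size_map.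
by move=> s s_t; apply: c_gt0; lia.
Qed.

Lemma num_merges_left_depth (R : realType) (n : nat) (I : n.-tuple (R * R))
    (sigma : schedule I) (t : nat) : 0 < t <= n ->
  num_merges sigma t = 1 + left_depth (tree_of R n I sigma) t.
Proof.
move=> t_n; have c_gt0 := compaction_gt0 R n I sigma.
rewrite -(left_depth_tree_at _ _ _ c_gt0 t_n); apply: eq_in_count => s.
rewrite mem_index_iota => s_n; rewrite merged_atE files_compacted //.
by case/andP: t_n s_n; lia.
Qed.

Theorem theorem2 (R : realType) (f : R -> R)
    (f_ge0 : forall x : R, (0 <= x)%R -> (0 <= f x)%R)
    (f_ndecr : forall x y : R, (0 <= x)%R -> (x <= y)%R -> (f x <= f y)%R)
    (n : nat) (I : n.-tuple (R * R)) (I_ge0 : is_instance I) :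
  exists phi : schedule I -> bst n,
    bijective phi /\
    forall sigma : schedule I,
      (forall t : nat, 1 <= t <= n ->
         stack_size sigma t = 1 + right_depth (phi sigma) t /\
         num_merges sigma t = 1 + left_depth (phi sigma) t) /\
      \max_(1 <= t < n.+1) stack_size sigma t = latency (phi sigma) /\
      schedule_cost f sigma = tree_cost I f (phi sigma).
Proof.
exists (tree_of R n I); split; first exact: tree_of_bijective.
move=> sigma; split=> [t t_n|].
  by rewrite stack_sizeE // num_merges_left_depth.
split; first by apply: eq_big_nat => t t_n; rewrite stack_sizeE.
rewrite /schedule_cost /tree_cost !big_split /= sum_compaction_length.
by congr (_ + _)%R; apply: eq_big_nat => t t_n;
  rewrite ?stack_sizeE // num_merges_left_depth.
Qed.
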